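(* The proof system $\mathbf{M}^W$ is sound and strongly complete with respect to the class of $(m)$-frames.
   Context: Fix a nonempty set $\mathbf{P}$ of propositional variables, $p\in\mathbf{P}$. $\mathcal{L}(W)$: $\varphi::=p\mid\neg\varphi\mid\varphi\land\varphi\mid W\varphi$; other Boolean connectives are defined as usual. A neighborhood frame is $\langle S,N\rangle$ with $S$ a nonempty set and $N:S\to\mathcal{P}(\mathcal{P}(S))$; a model $\mathcal{M}=\langle S,N,V\rangle$ based on it adds $V:\mathbf{P}\to\mathcal{P}(S)$. With $\varphi^{\mathcal{M}}=\{s\in S\mid\mathcal{M},s\vDash\varphi\}$: $\mathcal{M},s\vDash p$ iff $s\in V(p)$; Boolean connectives as usual; $\mathcal{M},s\vDash W\varphi$ iff $\varphi^{\mathcal{M}}\in N(s)$ and $s\notin\varphi^{\mathcal{M}}$. An $(m)$-frame is one where, for all $s\in S$, $X\in N(s)$ and $X\subseteq Y\subseteq S$ imply $Y\in N(s)$. The proof system $\mathbf{M}^W$ for $\mathcal{L}(W)$ has as axioms all instances of propositional tautologies and all instances of $\texttt{WE}$: $W\varphi\to\neg\varphi$ and $\texttt{WM}$: $W(\varphi\land\psi)\land\neg\psi\to W\psi$; its rules are modus ponens and $\texttt{REW}$: from $\varphi\leftrightarrow\psi$ infer $W\varphi\leftrightarrow W\psi$ (applied to theorems). Sound with respect to a class of frames: every theorem is true at every state of every model based on a frame in the class. Strongly complete: for every set $\Gamma\cup\{\varphi\}$ of formulas, if $\varphi$ is true at every state, in every model based on a frame in the class, at which all of $\Gamma$ is true,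 then $\vdash\bigwedge\Gamma_0\to\varphi$ for some finite $\Gamma_0\subseteq\Gamma$ (equivalently, every consistent set is satisfiable in a model based on a frame in the class). *)

(* Defs.v *)
From mathcomp Require Import all_boot.
From mathcomp Require Import boolp classical_sets.
From Stdlib Require List.

Set Implicit Arguments.
Unset Strict Implicit.
Unset Printing Implicit Defensive.

Local Open Scope classical_set_scope.

(** * Language *)

Inductive form (P : Type) : Type :=
| Var of P
| Neg of form P
| And of form P & form P
| W of form P.

Arguments Var {P} _.

Definition Imp (P : Type) (phi psi : form P) : form P := Neg (And phi (Neg psi)).

Definition Iff (P : Type) (phi psi : form P) : form P :=
  And (Imp phi psi) (Imp psi phi).

(** The language has no constant for truth; [Top] is built from a variable [p],
    which is where nonemptiness of the set of variables is used. *)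
Definition Top (P : Type) (p : P) : form P := Neg (And (Var p) (Neg (Var p))).

(** Conjunction of a finite list; the empty conjunction is [Top p]. *)
Definition BigAnd (P : Type) (p : P) (l : seq (form P)) : form P :=
  foldr (@And P) (Top p) l.

(** * Neighborhood semantics *)

Record frame : Type := Frame {
  state : Type;
  state_nonempty : [set: state] !=set0;
  nbhd : state -> set (set state)
}.

Record model (P : Type) : Type := Model {
  model_frame : frame;
  valuation : P -> set (state model_frame)
}.

Fixpoint sat (P : Type) (M : model P) (s : state (model_frame M)) (phi : form P)
    {struct phi} : Prop :=
  match phi with
  | Var p => valuation p s
  | Neg psi => ~ sat s psi
  | And psi chi => sat s psi /\ sat s chi
  | W psi => nbhd s [set t | sat t psi] /\ ~ [set t | sat t psi] s
  end.

(** Classes of frames have type [frame -> Prop], not [set frame]: the latter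
    would put the universe of [state] strictly below that of [set], and sets of
    formulas could then not serve as the states of a frame. *)
Definition m_frame (F : frame) : Prop :=
  forall (s : state F) (X Y : set (state F)),
    nbhd s X -> X `<=` Y -> nbhd s Y.

(** * The proof system *)

(** Propositional formulas over countably many schematic letters: an instance of
    a propositional tautology is a substitution instance of a tautologous
    [pform]. *)
Inductive pform : Type :=
| PVar of nat
| PNeg of pform
| PAnd of pform & pform.

Fixpoint peval (v : nat -> bool) (a : pform) : bool :=
  match a with
  | PVar i => v i
  | PNeg b => ~~ peval v b
  | PAnd b c => peval v b && peval v c
  end.

Definition tautology (a : pform) : Prop := forall v : nat -> bool, peval v a.

Fixpoint psubst (P : Type) (sigma : nat -> form P) (a : pform) : form P :=
  match a with
  | PVar i => sigma i
  | PNeg b => Neg (psubst sigma b)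
  | PAnd b c => And (psubst sigma b) (psubst sigma c)
  end.

Inductive MW (P : Type) : form P -> Prop :=
| MW_TAUT (a : pform) (sigma : nat -> form P) :
    tautology a -> MW (psubst sigma a)
| MW_WE (phi : form P) : MW (Imp (W phi) (Neg phi))
| MW_WM (phi psi : form P) :
    MW (Imp (And (W (And phi psi)) (Neg psi)) (W psi))
| MW_MP (phi psi : form P) : MW (Imp phi psi) -> MW phi -> MW psi
| MW_REW (phi psi : form P) : MW (Iff phi psi) -> MW (Iff (W phi) (W psi)).

(** * Soundness and strong completeness of a set [L] of theorems *)

Definition sound (P : Type) (L : set (form P)) (C : frame -> Prop) : Prop :=
  forall phi : form P, L phi ->
  forall M : model P, C (model_frame M) ->
  forall s : state (model_frame M), sat s phi.

Definition entails (P : Type) (C : frame -> Prop) (Gamma : set (form P))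
    (phi : form P) : Prop :=
  forall M : model P, C (model_frame M) ->
  forall s : state (model_frame M),
    (forall psi : form P, Gamma psi -> sat s psi) -> sat s phi.

Definition strongly_complete (P : Type) (p : P) (L : set (form P))
    (C : frame -> Prop) : Prop :=
  forall (Gamma : set (form P)) (phi : form P), entails C Gamma phi ->
  exists Gamma0 : seq (form P),
    [set psi | List.In psi Gamma0] `<=` Gamma /\ L (Imp (BigAnd p Gamma0) phi).

(* Main.v *)
(** Completeness is by a canonical model whose states are the maximal consistent
    sets and in which [X] is a neighborhood of [A] as soon as [X] contains the
    truth set of some [phi] with [W phi] in [A]. Such a frame is monotone by
    construction. In the truth lemma for [W psi], if the truth set of [phi] is
    included in that of [psi], then [phi] is provably equivalent to
    [phi /\ psi], so that [W phi] gives [W (phi /\ psi)] by REW, and [WM] turns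
    this into [W psi] at every state where [psi] fails. *)

From HB Require Import structures.
From mathcomp Require Import all_boot.
From mathcomp Require Import boolp classical_sets.
From Stdlib Require List.
Require Import Defs.

Set Implicit Arguments.
Unset Strict Implicit.
Unset Printing Implicit Defensive.

Local Open Scope classical_set_scope.

(** * Soundness over monotone frames *)

Lemma sat_psubst (P : Type) (M : model P) (s : state (model_frame M))
    (sigma : nat -> form P) (a : pform) :
  sat s (psubst sigma a) <-> peval (fun i => `[< sat s (sigma i) >]) a.
Proof.
elim: a => [i|b IHb|b IHb c IHc] /=.
- by split=> [/asboolT|/asboolW].
- by rewrite IHb; split=> /negP.
- by rewrite IHb IHc; split=> /andP.
Qed.

Lemma sat_Imp (P : Type) (M : model P) (s : state (model_frame M))
    (phi psi : form P) :
  sat s (Imp phi psi) <-> (sat s phi -> sat s psi).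
Proof.
split=> /= [h hphi|h [hphi]]; last by apply; apply: h.
by apply: contrapT => hpsi; apply: h.
Qed.

Lemma sat_Iff (P : Type) (M : model P) (s : state (model_frame M))
    (phi psi : form P) :
  sat s (Iff phi psi) <-> (sat s phi <-> sat s psi).
Proof.
have -> : sat s (Iff phi psi) = (sat s (Imp phi psi) /\ sat s (Imp psi phi)) by [].
by rewrite !sat_Imp.
Qed.

Lemma MW_sound (P : Type) : sound (@MW P) m_frame.
Proof.
move=> phi; elim=> {phi} [a sigma ta|phi|phi psi|phi psi _ IH1 _ IH2
  |phi psi _ IH] M mM s.
- exact/sat_psubst/ta.
- by apply/sat_Imp => -[].
- apply/sat_Imp => -[[Ns _] npsi]; split=> //.
  (* Monotonicity applies because the truth set of [And phi psi] lies in that of [psi]. *)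
  by apply: mM Ns _ => t [].
- by have /sat_Imp := IH1 M mM s; apply; apply: IH2.
(* The induction hypothesis holds at all states of [M], so the two truth sets coincide and [nbhd]
   cannot tell them apart. *)
- have satE (t : state (model_frame M)) : sat t phi <-> sat t psi.
    by apply/sat_Iff/IH.
  suff setE : [set t : state (model_frame M) | sat t phi] = [set t | sat t psi].
    by apply/sat_Iff => /=; rewrite setE satE.
  by apply/seteqP; split=> t /satE.
Qed.

(** * Propositional reasoning *)

HB.instance Definition _ (P : Type) := gen_eqMixin (form P).

Definition boolean_valuation (P : Type) (h : form P -> bool) : Prop :=
  (forall phi, h (Neg phi) = ~~ h phi) /\
  (forall phi psi, h (And phi psi) = h phi && h psi).

Fixpoint atoms (P : Type) (phi : form P) : seq (form P) :=
  match phi with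
  | Neg psi => atoms psi
  | And psi chi => atoms psi ++ atoms chi
  | _ => [:: phi]
  end.

Fixpoint skeleton (P : Type) (l : seq (form P)) (phi : form P) : pform :=
  match phi with
  | Neg psi => PNeg (skeleton l psi)
  | And psi chi => PAnd (skeleton l psi) (skeleton l chi)
  | _ => PVar (index phi l)
  end.

(** Any [l] covering the atoms is allowed, so that the induction can keep the same list for both
    conjuncts. *)
Lemma psubst_skeleton (P : Type) (x0 : form P) (l : seq (form P))
    (phi : form P) :
  {subset atoms phi <= l} -> psubst (nth x0 l) (skeleton l phi) = phi.
Proof.
elim: phi => [q|psi IH|psi IHpsi chi IHchi|psi _] /= sub.
- by rewrite nth_index // sub // mem_head.
- by rewrite IH.
- by rewrite IHpsi ?IHchi // => x xin; apply: sub; rewrite mem_cat xin ?orbT.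
- by rewrite nth_index // sub // mem_head.
Qed.

(** Reading its [atoms] as letters makes [phi] an instance of its own [skeleton], and each
    assignment to the letters induces a Boolean valuation of all formulas. *)
Lemma MW_prop (P : Type) (phi : form P) :
  (forall h : form P -> bool, boolean_valuation h -> h phi) -> MW phi.
Proof.
move=> taut_phi; rewrite -(@psubst_skeleton P phi (atoms phi) phi) //.
apply: MW_TAUT => v.
exact: (taut_phi (fun psi => peval v (skeleton (atoms phi) psi))).
Qed.

Lemma valuation_Imp (P : Type) (h : form P -> bool) (phi psi : form P) :
  boolean_valuation h -> h (Imp phi psi) = (h phi ==> h psi).
Proof. by case=> hN hA; rewrite /Imp hN hA hN negb_and negbK implybE. Qed.

Lemma valuation_BigAnd (P : Type) (p : P) (h : form P -> bool)
    (l : seq (form P)) :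
  boolean_valuation h -> h (BigAnd p l) = all h l.
Proof.
move=> [hN hA]; elim: l => [|phi l IH] /=; last by rewrite hA -IH.
by rewrite /Top hN hA hN andbN.
Qed.

(** * Derivability from hypotheses *)

Definition derivable (P : Type) (p : P) (Gamma : set (form P))
    (phi : form P) : Prop :=
  exists Gamma0 : seq (form P),
    [set psi | List.In psi Gamma0] `<=` Gamma /\ MW (Imp (BigAnd p Gamma0) phi).

Lemma derivable_hyp (P : Type) (p : P) (Gamma : set (form P)) (phi : form P) :
  Gamma phi -> derivable p Gamma phi.
Proof.
move=> Gphi; exists [:: phi]; split; first by move=> psi [<-|[]].
apply: MW_prop => h vh.
by rewrite valuation_Imp // valuation_BigAnd //= andbT implybb.
Qed.

Lemma derivable_MW (P : Type) (p : P) (Gamma : set (form P)) (phi : form P) :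
  MW phi -> derivable p Gamma phi.
Proof.
move=> Mphi; exists [::]; split; first by move=> psi [].
apply: MW_MP Mphi; apply: MW_prop => h vh.
by rewrite !valuation_Imp //; case: (h phi); rewrite ?implybT.
Qed.

Lemma derivable_MP (P : Type) (p : P) (Gamma : set (form P))
    (phi psi : form P) :
  derivable p Gamma (Imp phi psi) -> derivable p Gamma phi ->
  derivable p Gamma psi.
Proof.
move=> [l1 [s1 M1]] [l2 [s2 M2]]; exists (l1 ++ l2); split.
  by move=> chi /= /(@List.in_app_or _ _ _ _) [/s1|/s2].
apply: MW_MP M2; apply: MW_MP M1; apply: MW_prop => h vh.
rewrite !valuation_Imp // !valuation_BigAnd // all_cat.
by case: (all h l1); case: (all h l2); case: (h phi); case: (h psi).
Qed.

Lemma derivable_prop (P : Type) (p : P) (Gamma : set (form P))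
    (phi psi chi : form P) :
  (forall h, boolean_valuation h -> h phi -> h psi -> h chi) ->
  derivable p Gamma phi -> derivable p Gamma psi -> derivable p Gamma chi.
Proof.
move=> cons Dphi Dpsi; apply: derivable_MP Dpsi; apply: derivable_MP Dphi.
apply/derivable_MW/MW_prop => h vh; rewrite !valuation_Imp //.
by apply/implyP => hphi; apply/implyP; apply: cons.
Qed.

Lemma deduction (P : Type) (p : P) (Gamma : set (form P)) (phi psi : form P) :
  derivable p (Gamma `|` [set phi]) psi -> derivable p Gamma (Imp phi psi).
Proof.
(* Dropping [phi] from [l] leaves only members of [Gamma]. *)
move=> [l [sl Ml]]; exists [seq chi <- l | chi != phi]; split.
  move=> chi /=.
  have -> : List.In chi [seq x <- l | x != phi] <->
      List.In chi l /\ chi != phi by apply: List.filter_In.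
  by move=> [/sl [//|/= ->]]; rewrite eqxx.
apply: MW_MP Ml; apply: MW_prop => h vh.
rewrite !valuation_Imp // !valuation_BigAnd //.
suff : all h [seq chi <- l | chi != phi] -> h phi -> all h l.
  case: (all h l); case: (h phi); case: (h psi); case: (all h _) => //=.
  by move=> /(_ isT isT).
move=> hl hphi; apply/allP => chi chil.
have [-> //|chiNphi] := eqVneq chi phi.
by apply: (allP hl); rewrite mem_filter chiNphi.
Qed.

(** * Lindenbaum's lemma *)

(** The maximal consistent sets, described as the Boolean-homomorphic sets of
    formulas that contain all theorems. *)
Record maximal (P : Type) (A : set (form P)) : Prop := Maximal {
  maximal_MW : forall phi, MW phi -> A phi;
  maximal_Neg : forall phi, A (Neg phi) <-> ~ A phi;
  maximal_And : forall phi psi, A (And phi psi) <-> A phi /\ A psi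
}.

Lemma maximal_Imp (P : Type) (A : set (form P)) (phi psi : form P) :
  maximal A -> A (Imp phi psi) <-> (A phi -> A psi).
Proof.
move=> mA; rewrite (maximal_Neg mA) (maximal_And mA) (maximal_Neg mA).
split=> [h Aphi|h [Aphi]]; last by apply; apply: h.
by apply: contrapT => nApsi; apply: h.
Qed.

(** Of two members of a chain the larger serves for both. The option [set0] covers an empty [F]. *)
Lemma chain_finite_subset (T : Type) (Gamma : set T) (F : set (set T))
    (l : seq T) :
  total_on F subset ->
  [set x | List.In x l] `<=` Gamma `|` \bigcup_(X in F) X ->
  exists2 X, X = set0 \/ F X & [set x | List.In x l] `<=` Gamma `|` X.
Proof.
move=> totF; elim: l => [_|x l IH sub].
  by exists set0; [left | move=> x []].
have [|X FX lX] := IH; first by move=> y yl; apply: sub; right.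
have [Gx|[Y FY Yx]] := sub x (or_introl erefl).
  by exists X => // y [<-|/lX //]; left.
have [XY|YX] : X `<=` Y \/ Y `<=` X.
- by case: FX => [->|FX]; [left; exact: sub0set | exact: totF].
- exists Y; first by right.
  by move=> y [<-|/lX [Gy|/XY Yy]]; [right|left|right].
- by exists X => // y [<-|/lX //]; right; apply: YX.
Qed.

Lemma lindenbaum (P : Type) (p : P) (Gamma : set (form P)) (phi : form P) :
  ~ derivable p Gamma phi ->
  exists A : set (form P), [/\ maximal A, Gamma `<=` A & ~ A phi].
Proof.
move=> nD.
(* Zorn is applied to the sets added to [Gamma], not to the extensions of [Gamma]: the empty chain
   has an empty union, which need not contain [Gamma]. *)
have [|X [nDX maxX]] := @Zorn_bigcup (form P)
    [set X | ~ derivable p (Gamma `|` X) phi].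
  move=> F FQ totF [l [/(chain_finite_subset totF) [X FX lX] Ml]].
  case: FX lX => [-> lX|FX lX]; last by apply: (FQ X FX); exists l.
  by apply: nD; exists l; rewrite -[Gamma]setU0.
pose A := Gamma `|` X.
(* By maximality of [X], adding a missing [chi] makes [phi] derivable. *)
have stepA chi : ~ A chi -> derivable p A (Imp chi phi).
  move=> nAchi; apply: deduction; rewrite /A -setUA; apply: contrapT.
  apply: maxX; split; first exact: subsetUl.
  by move=> sub; apply: nAchi; right; apply: sub; right.
have closedA chi : derivable p A chi -> A chi.
  move=> Dchi; apply: contrapT => /stepA Dimp.
  by apply: nDX; apply: derivable_MP Dimp Dchi.
exists A; split; [split| exact: subsetUl | by move=> /(@derivable_hyp _ p)].
- by move=> chi /(derivable_MW p A) /closedA.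
- move=> chi; split.
    move=> /(@derivable_hyp _ p) Dn /(@derivable_hyp _ p) Dc; apply: nDX.
    by apply: derivable_prop Dn Dc => h [hN _]; rewrite hN => /negbTE ->.
  (* If [A] missed both [chi] and its negation, each would imply [phi] over [A], and [phi] would
     follow by cases. *)
  move=> /stepA Dc; apply: contrapT => /stepA Dn; apply: nDX.
  apply: derivable_prop Dc Dn => h vh; rewrite !valuation_Imp // vh.1.
  by case: (h chi).
- move=> chi psi; split.
    move=> /(@derivable_hyp _ p) Dcp.
    by split; apply: closedA; apply: (derivable_prop _ Dcp Dcp) => h [_ hA];
      rewrite hA => /andP [].
  move=> [/(@derivable_hyp _ p) Dc /(@derivable_hyp _ p) Dp]; apply: closedA.
  by apply: derivable_prop Dc Dp => h [_ hA]; rewrite hA => -> ->.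
Qed.

(** Lindenbaum's lemma over no hypotheses; it turns inclusions between canonical truth sets into
    provability. *)
Lemma MW_of_maximal (P : Type) (p : P) (phi : form P) :
  (forall A : set (form P), maximal A -> A phi) -> MW phi.
Proof.
move=> allA; apply: contrapT => nM.
have [[l [sl Ml]]|A [mA _ /(_ (allA A mA))//]] := @lindenbaum P p set0 phi.
apply: nM; apply: MW_MP Ml _; apply: MW_prop => h vh.
(* A list drawn from [set0] is empty. *)
rewrite valuation_BigAnd //; case: l sl => // x l sl.
by case: (sl x (or_introl erefl)).
Qed.

(** * The canonical model *)

Section Canonical.
Variable P : Type.

Definition mcs : Type := {A : set (form P) | maximal A}.

Definition truth_set (phi : form P) : set mcs := [set B | sval B phi].

Definition canonical_nbhd (A : mcs) : set (set mcs) :=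
  [set X | exists2 phi, sval A (W phi) & truth_set phi `<=` X].

(** [A0] supplies the nonemptiness of the state space. *)
Definition canonical_frame (A0 : mcs) : frame :=
  @Frame mcs (ex_intro _ A0 I) canonical_nbhd.

Definition canonical_model (A0 : mcs) : model P :=
  @Model P (canonical_frame A0) (fun q => truth_set (Var q)).

Lemma canonical_m_frame (A0 : mcs) : m_frame (canonical_frame A0).
Proof.
move=> A X Y [phi Aphi subX] XY; exists phi => //.
exact: subset_trans XY.
Qed.

Lemma maximal_W_mono (p : P) (A : set (form P)) (phi psi : form P) :
  maximal A -> truth_set phi `<=` truth_set psi ->
  A (W phi) -> ~ A psi -> A (W psi).
Proof.
move=> mA sub AW nApsi.
have /MW_REW /(maximal_MW mA) : MW (Iff phi (And phi psi)).
  apply: (MW_of_maximal p) => B mB.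
  rewrite (maximal_And mB) !(maximal_Imp _ _ mB) !(maximal_And mB).
  by split=> [Bphi|[]//]; split=> //; apply: (sub (exist _ B mB)).
rewrite (maximal_And mA) !(maximal_Imp _ _ mA) => -[/(_ AW) AWand _].
have /(maximal_MW mA) := MW_WM phi psi.
rewrite (maximal_Imp _ _ mA) (maximal_And mA) (maximal_Neg mA).
by apply.
Qed.

Lemma truth_lemma (p : P) (A0 : mcs) (phi : form P)
    (A : state (model_frame (canonical_model A0))) :
  sat A phi <-> sval A phi.
Proof.
elim: phi A => [q|psi IH|psi IHpsi chi IHchi|psi IH] A /=; have mA := svalP A.
- by [].
- by rewrite IH (maximal_Neg mA).
- by rewrite IHpsi IHchi (maximal_And mA).
(* By induction the semantic truth set of [psi] is [truth_set psi], the form in which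
   [canonical_nbhd] speaks of it. *)
have -> : [set t : state (canonical_frame A0) | sat (M := canonical_model A0) t psi]
    = truth_set psi by apply/seteqP; split=> t /IH.
rewrite IH; split=> [[[phi AW sub] nA]|AW].
  exact: maximal_W_mono sub AW nA.
(* [psi] itself witnesses the neighborhood, and WE keeps [psi] out of [A]. *)
split; first by exists psi.
have /(maximal_MW mA) := MW_WE psi.
by rewrite (maximal_Imp _ _ mA) (maximal_Neg mA); apply.
Qed.

End Canonical.

(* [p] witnesses that the set [P] of propositional variables is nonempty. *)
Theorem theorem5p26 (P : Type) (p : P) :
  sound (@MW P) m_frame /\ strongly_complete p (@MW P) m_frame.
Proof.
split; first exact: MW_sound.
move=> Gamma phi ent; apply: contrapT.
(* If [phi] is not derivable, a maximal set that contains [Gamma] and omits [phi] is a state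
   refuting the entailment. *)
move=> /(@lindenbaum P p) [A [mA subA]]; apply.
pose A0 : mcs P := exist _ A mA.
apply/(truth_lemma p (A0 := A0) phi A0).
apply: (ent (canonical_model A0)) => [|psi /subA Apsi].
  exact: canonical_m_frame.
exact/truth_lemma.
Qed.
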